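(* Let $(R,\mathfrak{m})$ be a local Cohen--Macaulay domain of prime characteristic $p>0$. (a) If $R$ is one-dimensional and the test ideal of $R$ is equal to $\mathfrak{m}$, then all $\mathfrak{m}$-primary ideals of $R$ are $*$-basically full. (b) Assume (in addition to $R$ being a local Cohen--Macaulay domain of characteristic $p$) that $R$ is normal and has perfect residue field. Then $R$ is one-dimensional if and only if all $\mathfrak{m}$-primary ideals of $R$ are $*$-basically full.
   Context: Local rings are Noetherian. Let $(R,\mathfrak{m})$ be a local domain of prime characteristic $p>0$, and let $q$ denote positive integer powers of $p$. For an ideal $I\subseteq R$, $I^{[q]}$ is the ideal generated by $\{i^q : i\in I\}$. The tight closure $I^*$ of $I$ is the set of $x\in R$ for which there is $c\neq 0$ in $R$ with $cx^q\in I^{[q]}$ for all sufficiently large powers $q$ of $p$. The test ideal of $R$ is $\tau=\bigcap_{I\subseteq R}(I:I^* )$, the intersection over all ideals $I$ of $R$. An $\mathfrak{m}$-primary ideal $I$ is $*$-basically full if $(\mathfrak{m}I:\mathfrak{m})=I^*$, where $(\mathfrak{m}I:\mathfrak{m})=\{r\in R : r\mathfrak{m}\subseteq \mathfrak{m}I\}$. *)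

(* Defs.v *)
From HB Require Import structures.
From mathcomp Require Export all_boot all_algebra.
From mathcomp Require Export generic_quotient ring_quotient fraction.
From mathcomp Require Export boolp classical_sets.

Set Implicit Arguments.
Unset Strict Implicit.
Unset Printing Implicit Defensive.

Import GRing.Theory.
Local Open Scope ring_scope.
Local Open Scope classical_set_scope.

Section Ideals.
Context {R : comNzRingType}.
Implicit Types (A I J M P Q : set R) (s : seq R) (d n : nat).

(* Unlike [idealr_closed] of ring_quotient, this allows the unit ideal. *)
Definition is_ideal I : Prop :=
  [/\ I 0, (forall x y, I x -> I y -> I (x + y)) & (forall a x, I x -> I (a * x))].

Definition ideal_gen A : set R := smallest is_ideal A.

Definition ideal_mul I J : set R := ideal_gen [set x * y | x in I & y in J].

Definition ideal_colon I J : set R := [set r | forall x, J x -> I (r * x)].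

Definition radical I : set R := [set x | exists n, I (x ^+ n)].

Definition prime_ideal P : Prop :=
  [/\ is_ideal P, P <> setT & forall x y, P (x * y) -> P x \/ P y].

Definition maximal_ideal M : Prop :=
  [/\ is_ideal M, M <> setT &
      forall J, is_ideal J -> M `<=` J -> J = M \/ J = setT].

Definition primary_ideal Q : Prop :=
  [/\ is_ideal Q, Q <> setT &
      forall x y, Q (x * y) -> Q x \/ exists n, Q (y ^+ n)].

Definition primary_to M I : Prop := primary_ideal I /\ radical I = M.

Definition prime_chain n (P : nat -> set R) : Prop :=
  (forall i, (i <= n)%N -> prime_ideal (P i)) /\
  (forall i, (i < n)%N -> P i `<` P i.+1).

Definition regular_seq s : Prop :=
  ideal_gen [set` s] <> setT /\
  forall i, (i < size s)%N -> forall x,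
    ideal_gen [set` take i s] (s`_i * x) -> ideal_gen [set` take i s] x.

(* The depth of a local ring with maximal ideal M: the supremum of the lengths
   of regular sequences contained in M. *)
Definition has_depth M d : Prop :=
  (exists s, [/\ regular_seq s, [set` s] `<=` M & size s = d]) /\
  (forall s, regular_seq s -> [set` s] `<=` M -> (size s <= d)%N).

End Ideals.

Definition noetherian (R : comNzRingType) : Prop :=
  forall I : set R, is_ideal I -> exists s : seq R, I = ideal_gen [set` s].

Definition has_krull_dim (R : comNzRingType) (d : nat) : Prop :=
  (exists P : nat -> set R, prime_chain d P) /\
  (forall (n : nat) (P : nat -> set R), prime_chain n P -> (n <= d)%N).

(* Local rings are Noetherian by convention. *)
Definition local_ring (R : comNzRingType) (M : set R) : Prop :=
  [/\ noetherian R, maximal_ideal M & forall M', maximal_ideal M' -> M' = M].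

Definition cohen_macaulay (R : comNzRingType) (M : set R) : Prop :=
  exists2 d, has_krull_dim R d & has_depth M d.

Definition normal_domain (R : idomainType) : Prop :=
  forall z : {fraction R}, integralOver (@tofrac R) z -> exists x, z = tofrac x.

(* Meant for fields; it is stated over rings because [{ideal_quot m}] is not
   registered as a [fieldType], even when [m] is maximal.  Perfectness is
   "characteristic 0 or surjective Frobenius". *)
Definition perfect_field (K : comNzRingType) : Prop :=
  forall p, p \in [pchar K] -> forall y : K, exists x : K, x ^+ p = y.

Section TightClosure.
Context {R : idomainType}.
Variable p : nat.
Implicit Types I M : set R.

Definition frobenius_power I (q : nat) : set R :=
  ideal_gen [set i ^+ q | i in I].

Definition tight_closure I : set R :=
  [set x | exists2 c : R, c != 0 & exists N : nat, forall e, (N <= e)%N ->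
     frobenius_power I (p ^ e) (c * x ^+ (p ^ e))].

Definition test_ideal : set R :=
  \bigcap_(I in [set I | is_ideal I]) ideal_colon I (tight_closure I).

Definition star_basically_full M I : Prop :=
  ideal_colon (ideal_mul M I) M = tight_closure I.

End TightClosure.

(* Main.v *)
Require Import Defs.
From mathcomp Require Import ring.

(** Dimension one. Let [B = (M : M)] be the multiplier ring of the maximal ideal
    [M] inside the fraction field. If the test ideal is [M], or if [R] is normal,
    then [B] contains every [z] such that the elements [z ^ (p ^ e)] have a common
    denominator, that is, [B] is the integral closure of [R]
    ([test_ideal_frobenius_closed], [normal_frobenius_closed]). In dimension one
    this makes all non-zero ideals invertible over [B] ([colon_product1]), as over
    a Dedekind ring. Since [M B = M], both [(M I : M)] and [I^*] are the
    intersection of [I B] with [R]: multiplying by [(B : I)] shows that [I^*] is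
    in [I B], so that [M I^*] is in [M I B = M I]; and [r M] in [M I] gives [r] in
    [I B] because [M] is invertible over [B], while any non-zero
    element of [M] serves as a multiplier in the definition of [I^*]
    ([dim1_star_basically_full]).

    Dimension at least two. Let [f_1, ..., f_n] generate [M]. Because the depth is
    at least two, every non-zero element of [M] has an element of [M] regular modulo
    it ([regular_mod_exists]); choose [x_1, ..., x_n] in [M], each regular modulo
    the corresponding [f_i] and modulo the other [x_j]. Put [u = x_1 ... x_n] and
    let [t] be the list of the [f_i u / x_i]. Then [u M] is in [M (t)], so [u] is
    in [(M I : M)] for every ideal [I] containing [t]. On the other hand
    [z u ^ q = \sum_i b_i (f_i u / x_i) ^ q] forces [x_i ^ q] to divide [b_i], hence
    [z] to be in [M^[q]] ([separating_generators]). If [(M I : M) = I^*] held for all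
    [M]-primary [I], the first fact would put [u] in [I^*], so [u ^ p] in the tight
    closure of [I^[p]], and [M u ^ p] would be in [I^[p]] for ideals [I]
    arbitrarily close to [(t)]; by the second fact [M] would be in [M ^ 2]
    ([not_all_star_basically_full]).

    Dimension zero. Here [M = 0], and [(0 : 0)] is the whole field while [0^* = 0]
    ([field_not_star_basically_full]). *)

Set Implicit Arguments.
Unset Strict Implicit.
Unset Printing Implicit Defensive.

Import GRing.Theory.
Local Open Scope ring_scope.
Local Open Scope classical_set_scope.

(** * Ideals and the ascending chain condition *)

Section IdealGeneralities.
Context {R : comNzRingType}.
Implicit Types (A I J P : set R) (s t : seq R).

Lemma ideal_gen_ideal A : is_ideal (ideal_gen A).
Proof.
split=> [J [[]]//|x y gx gy J [hJ AJ]|a x gx J [hJ AJ]].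
  by case: (hJ) => _ hD _; apply: hD; [exact: (gx J)|exact: (gy J)].
by case: (hJ) => _ _ hM; apply: hM; exact: (gx J).
Qed.

Lemma ideal_gen_sub A : A `<=` ideal_gen A.
Proof. exact: sub_gen_smallest. Qed.

Lemma ideal_gen_min A J : is_ideal J -> A `<=` J -> ideal_gen A `<=` J.
Proof. exact: smallest_sub. Qed.

Lemma ideal_gen_mono A B : A `<=` B -> ideal_gen A `<=` ideal_gen B.
Proof.
move=> AB; apply: ideal_gen_min; first exact: ideal_gen_ideal.
by apply: subset_trans (@ideal_gen_sub B).
Qed.

Lemma ideal_mulr I a x : is_ideal I -> I x -> I (x * a).
Proof. by case=> _ _ hM Ix; rewrite mulrC; apply: hM. Qed.

Lemma ideal_sub I x y : is_ideal I -> I x -> I y -> I (x - y).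
Proof. by case=> _ hD hM Ix Iy; apply: hD => //; rewrite -mulN1r; apply: hM. Qed.

Lemma ideal_eqT I : is_ideal I -> I 1 -> I = setT.
Proof.
by move=> hI I1; apply/seteqP; split=> // x _; rewrite -(mul1r x); apply: ideal_mulr.
Qed.

Lemma ideal_expW I x n k : is_ideal I -> (n <= k)%N -> I (x ^+ n) -> I (x ^+ k).
Proof. by move=> hI le_nk Ixn; rewrite -(subnKC le_nk) exprD; apply: ideal_mulr. Qed.

Lemma zero_ideal : is_ideal [set 0 : R].
Proof.
by split=> [//|x y -> ->|a x ->]; rewrite /= ?addr0 ?mulr0.
Qed.

Lemma ideal_preim I a : is_ideal I -> is_ideal [set x | I (x * a)].
Proof.
case=> h0 hD hM; split=> /= [|x y|b x]; first by rewrite mul0r.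
  by rewrite mulrDl; apply: hD.
by rewrite -mulrA; apply: hM.
Qed.

Definition multiples (a : R) : set R := [set x | exists r, x = r * a].

Lemma multiples_ideal a : is_ideal (multiples a).
Proof.
split=> [|x y [r ->] [s ->]|b x [r ->]]; first by exists 0; rewrite mul0r.
  by exists (r + s); rewrite mulrDl.
by exists (b * r); rewrite mulrA.
Qed.

Lemma multiples_self a : multiples a a.
Proof. by exists 1; rewrite mul1r. Qed.

Definition adjoin I a : set R := [set x | exists2 y, I y & exists r, x = y + r * a].

Lemma adjoin_ideal I a : is_ideal I -> is_ideal (adjoin I a).
Proof.
case=> h0 hD hM; split=> [|x y|b x].
- by exists 0 => //; exists 0; rewrite mul0r addr0.
- move=> [u Iu [r ->]] [v Iv [s ->]]; exists (u + v); first exact: hD.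
  by exists (r + s); ring.
- move=> [u Iu [r ->]]; exists (b * u); first exact: hM.
  by exists (b * r); ring.
Qed.

Lemma adjoin_sub I a : I `<=` adjoin I a.
Proof. by move=> x Ix; exists x => //; exists 0; rewrite mul0r addr0. Qed.

Lemma adjoin_self I a : is_ideal I -> adjoin I a a.
Proof. by case=> h0 _ _; exists 0 => //; exists 1; rewrite mul1r add0r. Qed.

Lemma adjoin_neq I a : is_ideal I -> ~ I a -> adjoin I a <> I.
Proof. by move=> hI nIa E; apply: nIa; rewrite -E; apply: adjoin_self. Qed.

Lemma ideal_gen_cons a s x :
  ideal_gen [set` a :: s] x -> exists r, ideal_gen [set` s] (x - r * a).
Proof.
pose J : set R := adjoin (ideal_gen [set` s]) a.
have hJ : is_ideal J by apply: adjoin_ideal; apply: ideal_gen_ideal.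
move=> gx; have : J x.
  apply: (ideal_gen_min hJ) gx => y /=; rewrite inE => /orP[/eqP->|ys].
    by apply: adjoin_self; apply: ideal_gen_ideal.
  by apply: adjoin_sub; apply: ideal_gen_sub.
by case=> y gy [r ->]; exists r; rewrite addrK.
Qed.

Lemma ideal_gen_nil x : ideal_gen [set` [::] : seq R] x -> x = 0.
Proof. by move/(ideal_gen_min zero_ideal); apply=> y /=; rewrite inE. Qed.

Lemma combination_ideal (a : nat -> R) :
  is_ideal [set x | exists n (r : nat -> R), x = \sum_(i < n) r i * a i].
Proof.
have widen n (r : nat -> R) k : (n <= k)%N ->
    \sum_(i < n) r i * a i = \sum_(i < k) (if (i < n)%N then r i else 0) * a i.
  move=> le_nk; rewrite (big_ord_widen_cond k xpredT (fun i => r i * a i)) //=.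
  by rewrite big_mkcond /=; apply: eq_bigr => i _; case: ifP; rewrite ?mul0r.
split=> [|x y [n [r ->]] [k [u ->]]|b x [n [r ->]]].
- by exists 0, (fun=> 0); rewrite big_ord0.
- exists (maxn n k), (fun i => (if (i < n)%N then r i else 0)
                             + (if (i < k)%N then u i else 0)).
  rewrite (widen n r (maxn n k)) ?leq_maxl // (widen k u (maxn n k)) ?leq_maxr //.
  by rewrite -big_split; apply: eq_bigr => i _; rewrite mulrDl.
- exists n, (fun i => b * r i); rewrite mulr_sumr.
  by apply: eq_bigr => i _; rewrite mulrA.
Qed.

(** The form in which the chain condition is used: the ideals generated by the
    first terms of a sequence stop growing, so that some term depends linearly
    on its predecessors. *)
Lemma noetherian_dependence (a : nat -> R) : noetherian R ->
  exists n (r : nat -> R), a n = \sum_(i < n) r i * a i.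
Proof.
move=> noeth.
pose U n := [set x | exists r : nat -> R, x = \sum_(i < n) r i * a i].
have [s genE] := noeth _ (combination_ideal a).
have mono n k : (n <= k)%N -> U n `<=` U k.
  move=> le_nk x [r ->]; exists (fun i => if (i < n)%N then r i else 0).
  rewrite (big_ord_widen_cond k xpredT (fun i => r i * a i)) //=.
  by rewrite big_mkcond /=; apply: eq_bigr => i _; case: ifP; rewrite ?mul0r.
have [n Us] : exists n, [set` s] `<=` U n.
  have : [set` s] `<=` [set x | exists n, U n x].
    by move=> x xs; have := ideal_gen_sub xs; rewrite -genE.
  elim: (s) => [|x s' IHs] sU; first by exists 0 => x /=; rewrite inE.
  have [|n Un] := IHs; first by move=> y ys; apply: sU; rewrite /= inE [y \in _]ys orbT.
  have [|k Uk] := sU x; first by rewrite /= mem_head.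
  exists (maxn n k) => y /=; rewrite inE => /orP[/eqP->|ys].
    exact: mono (leq_maxr _ _) _ Uk.
  by apply: mono (leq_maxl _ _) _ _; apply: Un.
have hU : is_ideal (U n).
  split=> [|x y [r ->] [u ->]|b x [r ->]].
  - by exists (fun=> 0); rewrite big1 // => i _; rewrite mul0r.
  - exists (fun i => r i + u i); rewrite -big_split.
    by apply: eq_bigr => i _; rewrite mulrDl.
  - exists (fun i => b * r i); rewrite mulr_sumr.
    by apply: eq_bigr => i _; rewrite mulrA.
suff [r anE] : U n (a n) by exists n, r.
apply: (ideal_gen_min hU Us); rewrite -genE.
exists n.+1, (fun i => (i == n)%:R); rewrite big_ord_recr /= eqxx mul1r big1 ?add0r // => i _.
by rewrite (ltn_eqF (ltn_ord i)) mul0r.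
Qed.

Lemma noetherian_maximal (F : set (set R)) I : noetherian R ->
  (forall J, F J -> is_ideal J) -> F I ->
  exists P, [/\ F P, I `<=` P & forall J, F J -> P `<=` J -> J = P].
Proof.
move=> noeth hF FI; apply: contrapT => nmax.
have bigger P : exists J, F P /\ I `<=` P -> [/\ F J, P `<=` J & J <> P].
  apply: contrapT => nJ; have FP : F P /\ I `<=` P.
    by apply: contrapT => nFP; apply: nJ; exists P => /nFP.
  apply: nmax; exists P; split; try by case: FP.
  by move=> J FJ PJ; apply: contrapT => JP; apply: nJ; exists J.
have [g gP] := choice bigger.
pose C n := iter n g I.
have FC n : F (C n) /\ I `<=` C n.
  elim: n => [|n IHn]; first by split.
  have [FS CS _] := gP _ IHn; split=> //.
  by apply: subset_trans CS; case: IHn.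
have stepC n : C n `<=` C n.+1 by have [] := gP _ (FC n).
have monoC n k : (n <= k)%N -> C n `<=` C k.
  move=> /subnKC <-; elim: (k - n)%N => [|j IHj]; first by rewrite addn0.
  by rewrite addnS; apply: subset_trans (stepC _).
have new n : exists x, C n.+1 x /\ ~ C n x.
  have [_ CS neq] := gP _ (FC n); apply: contrapT => nx; apply: neq.
  apply/seteqP; split=> // x Cx; apply: contrapT => nCx; apply: nx.
  by exists x.
have [a aP] := choice new.
have [n [r an]] := noetherian_dependence a noeth.
have [_ []] := aP n; rewrite an.
have [C0 hD hM] := hF _ (FC n).1.
elim/big_ind: _ => // i _; apply: hM.
by apply: monoC (ltn_ord i) _ _; case: (aP i).
Qed.

End IdealGeneralities.

(** * Noetherian local domains *)

Section LocalDomain.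
Context {R : idomainType} {M : set R}.
Hypothesis hlocal : local_ring M.
Implicit Types (I J P : set R) (s t : seq R).

Let noeth : noetherian R. Proof. by case: hlocal. Qed.

Lemma local_ideal : is_ideal M. Proof. by case: hlocal => _ []. Qed.

Lemma local_not1 : ~ M 1.
Proof. by case: hlocal => _ [hM MT _] _ /(ideal_eqT hM). Qed.

Lemma proper_ideal_sub I : is_ideal I -> ~ I 1 -> I `<=` M.
Proof.
move=> hI nI1.
have [|//|P [[hP nP1] IP maxP]] :=
  @noetherian_maximal _ [set J | is_ideal J /\ ~ J 1] I noeth.
  by move=> J [].
case: hlocal => _ _ uniqM; rewrite -(uniqM P) //.
split=> // [PT|J hJ PJ]; first by apply: nP1; rewrite PT.
have [J1|nJ1] := pselect (J 1); [right; exact: ideal_eqT|left].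
exact: maxP.
Qed.

Lemma local_unit x : ~ M x -> exists y, y * x = 1.
Proof.
move=> nMx; apply: contrapT => nu; apply: nMx.
apply: (proper_ideal_sub (multiples_ideal x)); last exact: multiples_self.
by case=> y yx; apply: nu; exists y.
Qed.

Lemma local_unit_1sub x : M x -> exists y, y * (1 - x) = 1.
Proof.
move=> Mx; apply: local_unit => M1x; apply: local_not1.
by rewrite -(subrK x 1); case: local_ideal => _ hD _; apply: hD.
Qed.

Lemma local_prime x y : M (x * y) -> ~ M x -> M y.
Proof.
move=> Mxy /local_unit[z zx]; rewrite -(mul1r y) -zx -mulrA.
by case: local_ideal => _ _ hM; apply: hM.
Qed.

Lemma local_prime_ideal : prime_ideal M.
Proof.
split=> [|MT|x y Mxy]; [exact: local_ideal|by apply: local_not1; rewrite MT|].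
by have [Mx|/(local_prime Mxy)] := pselect (M x); [left|right].
Qed.

Lemma zero_prime_ideal : prime_ideal [set 0 : R].
Proof.
split=> [|E|x y /eqP]; first exact: zero_ideal.
  by have : [set 0 : R] 1 by [rewrite E]; move/eqP; rewrite oner_eq0.
by rewrite mulf_eq0 => /orP[]/eqP; [left|right].
Qed.

Lemma prime_avoiding I x : is_ideal I -> (forall n, ~ I (x ^+ n)) ->
  exists P, [/\ prime_ideal P, I `<=` P & ~ P x].
Proof.
move=> hI nIx.
have [|//|P [[hP nPx] IP maxP]] :=
  @noetherian_maximal _ [set J | is_ideal J /\ forall n, ~ J (x ^+ n)] I noeth.
  by move=> J [].
exists P; split=> //; last by move: (nPx 1%N); rewrite expr1.
have meet a : ~ P a -> exists n, adjoin P a (x ^+ n).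
  move=> nPa; apply: contrapT => nn; apply: (adjoin_neq hP nPa).
  apply: maxP; last exact: adjoin_sub.
  by split; [exact: adjoin_ideal|move=> n Jn; apply: nn; exists n].
split=> // [PT|a b Pab]; first by apply: (nPx 0%N); rewrite PT.
apply: contrapT => /not_orP[/meet[i [u Pu [r Ei]]] /meet[j [v Pv [w Ej]]]].
apply: (nPx (i + j)%N); rewrite exprD Ei Ej.
case: (hP) => _ hD hM.
have -> : (u + r * a) * (v + w * b) = (v + w * b) * u + ((r * a) * v + (r * w) * (a * b)).
  by ring.
apply: (hD); first exact: hM.
by apply: (hD); apply: hM.
Qed.

(** A prime containing [c] but not [x] would be strictly between [0] and [M]. *)
Lemma dim1_power_dvd c x : has_krull_dim R 1 -> c != 0 -> M x ->
  exists n, multiples c (x ^+ n).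
Proof.
move=> [_ dim1] c0 Mx; apply: contrapT => nn.
have [|P [primeP cP nPx]] := prime_avoiding (multiples_ideal c) (x := x).
  by move=> n cn; apply: nn; exists n.
have := dim1 2%N (fun i => if i is 0%N then [set 0] else if i is 1%N then P else M).
move=> /(_ _)/negP; apply=> //; split=> [[|[|i]] _|[|[|//]] _].
- exact: zero_prime_ideal.
- exact: primeP.
- exact: local_prime_ideal.
- case: (primeP) => -[P0 _ _] _ _; split=> [y -> //|/(_ c) P_0].
  by move/eqP: c0; apply; apply: P_0; apply: cP; exact: multiples_self.
- split=> [|/(_ x Mx)//]; apply: proper_ideal_sub; first by case: primeP.
  by case: (primeP) => hP PT _ /(ideal_eqT hP).
Qed.

Lemma dim1_nonzero : has_krull_dim R 1 -> exists2 t, M t & t != 0.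
Proof.
move=> [[P [primeP strictP]] _]; apply: contrapT => nt.
have [hP PT _] := primeP 1%N (leqnn _).
have [hP0 _ _] := primeP 0%N isT.
have [_ []] := strictP 0%N isT.
move=> x Px; have -> : x = 0; last by case: hP0.
apply: contrapT => /eqP x0; apply: nt; exists x => //.
by apply: (proper_ideal_sub hP) => // P1; apply: PT; apply: ideal_eqT.
Qed.

(** A linear dependence between the quotients [c / t ^ n] shows that [1] is a
    multiple of [t]. *)
Lemma krull_principal (t c : R) : M t -> (forall n, multiples (t ^+ n) c) -> c = 0.
Proof.
move=> Mt /choice[d dP]; apply: contrapT => /eqP c0.
have t0 : t != 0.
  by apply: contra_neq c0 => t0; rewrite (dP 1%N) expr1 t0 mulr0.
have stepd n : d n = d n.+1 * t.
  apply: (mulIf (expf_neq0 n t0)); rewrite -mulrA -exprS -dP; exact: dP.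
have dvdd i k : d i = d (i + k)%N * t ^+ k.
  elim: k => [|k IHk]; first by rewrite addn0 expr0 mulr1.
  by rewrite IHk addnS stepd exprS mulrA.
have [n [r dn]] := noetherian_dependence d noeth.
have [y dn_y] : exists y, d n = (y * t) * d n.
  rewrite {1}dn; apply: (@big_ind R (fun z => exists y, z = (y * t) * d n)).
  - by exists 0; rewrite !mul0r.
  - by move=> _ _ [y ->] [z ->]; exists (y + z); ring.
  - move=> i _; rewrite (dvdd i (n - i)%N) subnKC ?(ltnW (ltn_ord i)) //.
    have /subnSK <- := ltn_ord i.
    by exists (r i * t ^+ (n - i.+1)); rewrite exprS; ring.
have d0 : d n != 0 by apply: contra_neq c0 => d0; rewrite (dP n) d0 mul0r.
apply: local_not1; have -> : 1 = y * t by apply: (mulIf d0); rewrite mul1r.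
by case: local_ideal => _ _ hM; apply: hM.
Qed.

Lemma local_primary I : is_ideal I -> I `<=` M ->
  (forall x, M x -> exists n, I (x ^+ n)) -> primary_to M I.
Proof.
move=> hI IM powI; have radM : radical I = M.
  apply/seteqP; split=> x; last exact: powI.
  case=> n /IM; elim: n => [|n IHn]; first by rewrite expr0 => /local_not1.
  by rewrite exprS => Mxn; apply: contrapT => nMx; exact: (nMx (IHn (local_prime Mxn nMx))).
split=> //; split=> // [IT|x y Ixy]; first by apply: local_not1; apply: IM; rewrite IT.
have [My|/local_unit[z zy]] := pselect (M y); [right; exact: powI|left].
by rewrite -(mulr1 x) -zy (mulrC z) mulrA; apply: ideal_mulr.
Qed.

(** Nakayama's lemma for [M]: a submodule [N] maximal among the proper ones of [M]
    contains [M ^ 2], the quotient [M / N] being simple. *)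
Lemma square_proper (t : R) : M t -> t != 0 ->
  exists N, [/\ is_ideal N, (forall x y, M x -> M y -> N (x * y)) & exists2 z, M z & ~ N z].
Proof.
move=> Mt t0; have hM := local_ideal.
pose F : set (set R) := [set J | [/\ is_ideal J, J `<=` M & J <> M]].
have [||N [[hN NM neqN] _ maxN]] := @noetherian_maximal _ F [set 0] noeth.
- by move=> J [].
- split; [exact: zero_ideal|by case: hM => h0 _ _ _ ->|].
  by move=> E; move: Mt; rewrite -E => /eqP; rewrite (negbTE t0).
exists N; split=> //; last first.
  apply: contrapT => nz; apply: neqN; apply/seteqP; split=> // z Mz.
  by apply: contrapT => nNz; apply: nz; exists z.
move=> x y Mx My; apply: contrapT => nNxy.
have adjM : adjoin N (x * y) = M.
  apply: contrapT => neq; apply: (adjoin_neq hN nNxy); apply: maxN; last exact: adjoin_sub.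
  split=> //; first exact: adjoin_ideal.
  case: (hM) => _ hD hMul z [u Nu [r ->]].
  by apply: hD; [apply: NM|do 2!apply: (hMul)].
have [z Nz [r Ey]] : adjoin N (x * y) y by rewrite adjM.
have [w w1] : exists w, w * (1 - r * x) = 1.
  by apply: local_unit_1sub; case: hM => _ _; apply.
apply: nNxy; case: (hN) => _ _ hMul; apply: (hMul).
have -> : y = w * z; last exact: hMul.
have -> : z = (1 - r * x) * y by rewrite -[z](addrK (r * (x * y))) -Ey; ring.
by rewrite mulrA w1 mul1r.
Qed.

(** A form of the Krull intersection theorem: an ideal maximal among those
    avoiding [v] contains a power of each non-unit [x], because with
    [Q : x ^ n = Q : x ^ (n + 1)] and [x ^ n] outside [Q] the element [v]
    would be in [Q + (x ^ n)], hence in [Q]. *)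
Lemma primary_separation I v : is_ideal I -> ~ I v ->
  exists Q, [/\ is_ideal Q, I `<=` Q, ~ Q v & forall x, M x -> exists n, Q (x ^+ n)].
Proof.
move=> hI nIv.
have [|//|Q [[hQ nQv] IQ maxQ]] :=
  @noetherian_maximal _ [set J | is_ideal J /\ ~ J v] I noeth.
  by move=> J [].
exists Q; split=> // x Mx; apply: contrapT => nQx.
have inv a : ~ Q a -> adjoin Q a v.
  move=> nQa; apply: contrapT => nv; apply: (adjoin_neq hQ nQa).
  by apply: maxQ; [split=> //; exact: adjoin_ideal|exact: adjoin_sub].
case: (hQ) => Q0 QD QM.
have Qvx : Q (v * x).
  apply: contrapT => /inv[u Qu [r Ev]].
  have [w w1] : exists w, w * (1 - r * x) = 1.
    by apply: local_unit_1sub; case: local_ideal => _ _; apply.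
  apply: nQv; have -> : v = w * u; last exact: QM.
  have -> : u = (1 - r * x) * v by rewrite -[u](addrK (r * (v * x))) -Ev; ring.
  by rewrite mulrA w1 mul1r.
have nQxn n : ~ Q (x ^+ n) by move=> Qn; apply: nQx; exists n.
have [n stable] : exists n, forall r, Q (r * x ^+ n.+1) -> Q (r * x ^+ n).
  pose F : set (set R) := range (fun n => [set r | Q (r * x ^+ n)]).
  have [||P [[n _ <-] _ maxP]] :=
      @noetherian_maximal _ F [set r | Q (r * x ^+ 0)] noeth.
  - by move=> _ [n _ <-]; apply: ideal_preim.
  - by exists 0%N.
  have eqQ : [set r | Q (r * x ^+ n.+1)] = [set r | Q (r * x ^+ n)].
    apply: maxP; first by exists n.+1.
    by move=> u /= Qu; rewrite exprSr mulrA; apply: ideal_mulr.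
  by exists n => r Qr; change ([set r | Q (r * x ^+ n)] r); rewrite -eqQ.
have [u Qu [r Ev]] := inv _ (nQxn n).
apply: nQv; rewrite Ev; apply: QD => //; apply: stable.
rewrite exprSr mulrA.
have -> : r * x ^+ n * x = v * x - x * u by rewrite Ev; ring.
by apply: ideal_sub => //; apply: QM.
Qed.

End LocalDomain.

(** * Frobenius powers and tight closure *)

Section IdealProducts.
Context {R : comNzRingType}.
Implicit Types (I J K : set R).

Lemma ideal_mul_ideal I J : is_ideal (ideal_mul I J).
Proof. exact: ideal_gen_ideal. Qed.

Lemma ideal_mul_in I J x y : I x -> J y -> ideal_mul I J (x * y).
Proof. by move=> Ix Jy; apply: ideal_gen_sub; exists x => //; exists y. Qed.

Lemma ideal_mul_min I J K : is_ideal K ->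
  (forall x y, I x -> J y -> K (x * y)) -> ideal_mul I J `<=` K.
Proof. by move=> hK IJK; apply: ideal_gen_min => // _ [x Ix [y Jy <-]]; apply: IJK. Qed.

Lemma ideal_mul_subr I J : is_ideal J -> ideal_mul I J `<=` J.
Proof. by move=> hJ; apply: ideal_mul_min => // x y _ Jy; case: hJ => _ _; apply. Qed.

End IdealProducts.

Section Frobenius.
Context {p : nat}.

Lemma pchar_exprD (S : comNzRingType) (x y : S) e : p \in [pchar S] ->
  (x + y) ^+ (p ^ e) = x ^+ (p ^ e) + y ^+ (p ^ e).
Proof.
by move=> hp; apply: exprDn_pchar; rewrite pnatX pnatE ?hp // (pcharf_prime hp).
Qed.

Context {R : idomainType}.
Hypothesis hchar : p \in [pchar R].
Implicit Types (I J : set R).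

Lemma expp_gt0 e : (0 < p ^ e)%N.
Proof. by rewrite expn_gt0 prime_gt0 // (pcharf_prime hchar). Qed.

Lemma frobenius_preim_ideal J e : is_ideal J -> is_ideal [set x | J (x ^+ (p ^ e))].
Proof.
case=> J0 JD JM; split=> /= [|x y Jx Jy|a x Jx].
- by rewrite expr0n gtn_eqF ?expp_gt0.
- by rewrite pchar_exprD //; apply: JD.
- by rewrite exprMn; apply: JM.
Qed.

Lemma frobenius_power_ideal I q : is_ideal (frobenius_power I q).
Proof. exact: ideal_gen_ideal. Qed.

Lemma frobenius_power_in I q i : I i -> frobenius_power I q (i ^+ q).
Proof. by move=> Ii; apply: ideal_gen_sub; exists i. Qed.

Lemma frobenius_power_min I J q : is_ideal J ->
  (forall i, I i -> J (i ^+ q)) -> frobenius_power I q `<=` J.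
Proof. by move=> hJ IJ; apply: ideal_gen_min => // _ [i Ii <-]; apply: IJ. Qed.

Lemma tight_closure_frobenius I x :
  tight_closure p I x -> tight_closure p (frobenius_power I p) (x ^+ p).
Proof.
case=> c c0 [N cx]; exists c => //; exists N => e le_Ne.
rewrite -exprM -expnS; move: (cx e.+1 (leqW le_Ne)).
apply: frobenius_power_min => [|i Ii]; first exact: frobenius_power_ideal.
by rewrite expnS exprM; do 2!apply: frobenius_power_in.
Qed.

End Frobenius.

(** * Depth at least two *)

Section RegularElements.
Context {R : idomainType}.
Implicit Types (x y : R).

Definition regular_mod x y : Prop :=
  forall r s, x * r = y * s -> exists s', r = y * s'.

Lemma regular_mod_sym x y : y != 0 -> regular_mod x y -> regular_mod y x.
Proof.
move=> y0 reg r s E; have [s' Es] := reg s r (esym E).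
by exists s'; apply: (mulfI y0); rewrite E Es; ring.
Qed.

Lemma regular_modX x y n : regular_mod x y -> regular_mod (x ^+ n) y.
Proof.
move=> reg; elim: n => [|n IHn] r s; first by rewrite expr0 mul1r => ->; exists s.
by rewrite exprS -mulrA => /reg[s' /IHn].
Qed.

Lemma regular_modXX x y i j : x != 0 -> y != 0 ->
  regular_mod x y -> regular_mod (x ^+ i) (y ^+ j).
Proof.
move=> x0 y0 reg; apply: regular_mod_sym; first exact: expf_neq0.
apply: regular_modX; apply: regular_mod_sym => //; exact: regular_modX.
Qed.

End RegularElements.

Section DepthTwo.
Context {R : idomainType} {M : set R}.
Hypothesis hlocal : local_ring M.

Let noeth : noetherian R. Proof. by case: hlocal. Qed.

(** Among the ideals [(y) : a] with [a] outside [(y)], a maximal one is prime. *)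
Lemma zero_divisor_prime (y g : R) : ~ regular_mod g y ->
  exists a, [/\ ~ multiples y a, multiples y (g * a) &
    forall r s, multiples y (r * (s * a)) -> multiples y (r * a) \/ multiples y (s * a)].
Proof.
move=> nreg; have hy := multiples_ideal y.
have [a0 [na0 ga0]] : exists a, ~ multiples y a /\ multiples y (g * a).
  apply: contrapT => na; apply: nreg => r s E; apply: contrapT => nr; apply: na.
  exists r; split; last by exists s; rewrite E mulrC.
  by case=> s' Er; apply: nr; exists s'; rewrite mulrC.
pose ann a : set R := [set r | multiples y (r * a)].
have [||P [[a na <-] ga maxP]] :=
    @noetherian_maximal _ [set ann a | a in [set a | ~ multiples y a]] (ann a0) noeth.
- by move=> _ [a _ <-]; apply: ideal_preim.
- by exists a0.
exists a; split=> //; first exact: ga.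
move=> r s yrsa; have [|nsa] := pselect (multiples y (s * a)); [by right|left].
suff eqann : ann (s * a) = ann a by change (ann a r); rewrite -eqann.
apply: maxP; first by exists (s * a).
by move=> w /= yw; rewrite /ann /= mulrCA; case: hy => _ _; apply.
Qed.

(** For [M] would otherwise be covered by the primes of zero divisors
    [(y) : a i], where [a i] is killed by [x1 + x2 ^ (i + 1)]. No two of these
    elements lie in the same such prime, since it would contain [x2], hence
    [x1]; so the product of the first [n] of them is not in [(y) : a n],
    although it is when [a n] is a linear combination of the previous [a i]. *)
Lemma regular_mod_exists (x1 x2 y : R) : M x1 -> M x2 -> x1 != 0 -> regular_mod x2 x1 ->
  y != 0 -> exists2 x, M x & regular_mod x y.
Proof.
move=> Mx1 Mx2 x10 reg y0; apply: contrapT => nx.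
case: (local_ideal hlocal) => M0 MD MM.
have [Y0 YD YM] := multiples_ideal y.
pose g i := x1 + x2 ^+ i.+1.
have Mg i : M (g i) by rewrite /g exprSr; apply: MD => //; apply: MM.
have /choice[a aP] : forall i, exists b, [/\ ~ multiples y b, multiples y (g i * b) &
    forall r s, multiples y (r * (s * b)) -> multiples y (r * b) \/ multiples y (s * b)].
  by move=> i; apply: zero_divisor_prime => regi; apply: nx; exists (g i).
have [n [r an]] := noetherian_dependence a noeth.
have [nan gan primen] := aP n.
have nboth : ~ (multiples y (x1 * a n) /\ multiples y (x2 * a n)).
  move=> [[b1 E1] [b2 E2]]; apply: nan.
  have [b' Eb] : exists b', b1 = x1 * b'.
    apply: (reg b1 b2); apply: (mulIf y0).
    by rewrite -!mulrA -E1 -E2; ring.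
  by exists b'; apply: (mulfI x10); rewrite E1 Eb; ring.
have ngi i : (i < n)%N -> ~ multiples y (g i * a n).
  move=> lt_in gi; apply: nboth.
  have x2k k : multiples y (x2 ^+ k * a n) -> multiples y (x2 * a n).
    elim: k => [|k IHk]; first by rewrite expr0 mul1r => /nan.
    by rewrite exprS -mulrA => /primen[//|/IHk].
  have yx2 : multiples y (x2 * a n).
    apply: (x2k i.+1).
    have [w w1] : exists w, w * (1 - x2 ^+ (n - i)) = 1.
      apply: (local_unit_1sub hlocal); rewrite -(subnSK lt_in) exprS.
      by apply: ideal_mulr => //; split.
    have -> : x2 ^+ i.+1 * a n = w * (g i * a n - g n * a n).
      have -> : g n = x1 + x2 ^+ (n - i) * x2 ^+ i.+1.
        by rewrite /g -exprD addnS subnK // ltnW.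
      by rewrite /g -[LHS]mul1r -w1; ring.
    by apply: (YM); apply: ideal_sub => //; split.
  split=> //; have -> : x1 * a n = g n * a n - x2 ^+ n * (x2 * a n).
    by rewrite /g exprSr; ring.
  by apply: ideal_sub => //; apply: YM.
pose S k := \prod_(i < k) g i.
have nS k : (k <= n)%N -> ~ multiples y (S k * a n).
  elim: k => [|k IHk] le_kn; first by rewrite /S big_ord0 mul1r.
  rewrite /S big_ord_recr /= -mulrA => /primen[|]; last exact: ngi.
  exact: IHk (ltnW le_kn).
apply: (nS n (leqnn n)); rewrite an mulr_sumr.
apply: big_ind => // i _; rewrite /S (bigD1 i) //=.
set T := \prod_(_ < _ | _) _.
have -> : g i * T * (r i * a i) = (T * r i) * (g i * a i) by ring.
by apply: YM; case: (aP i).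
Qed.

Hypothesis enough_regular : forall y, M y -> y != 0 -> exists2 x, M x & regular_mod x y.

Lemma ideal_gen_scale q (x : R) (t : seq R) w :
  ideal_gen [set` [seq v ^+ q | v <- [seq x * v | v <- t]]] w ->
  exists2 b, ideal_gen [set` [seq v ^+ q | v <- t]] b & w = x ^+ q * b.
Proof.
pose G := ideal_gen [set` [seq v ^+ q | v <- t]].
have [G0 GD GM] : is_ideal G by apply: ideal_gen_ideal.
have hJ : is_ideal [set w | exists2 b, G b & w = x ^+ q * b].
  split=> [|_ _ [b Gb ->] [c Gc ->]|a _ [b Gb ->]].
  - by exists 0; rewrite ?mulr0.
  - by exists (b + c); [exact: GD|rewrite mulrDr].
  - by exists (a * b); [exact: GM|ring].
apply: (ideal_gen_min hJ) => _ /= /mapP[_ /mapP[v vt ->] ->].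
by exists (v ^+ q); [apply: ideal_gen_sub; apply: map_f|rewrite exprMn].
Qed.

(** With [s] the list of the [f_i] and elements [x_i] regular modulo [f_i] and
    modulo each other, [u] is the product of the [x_i] and [t] consists of the
    [f_i * u / x_i]; in a regular ring of dimension two this gives
    [u = x * y] and [t = (x ^ 2, y ^ 2)]. Each [u * f_i] is [x_i] times an element
    of [t], and in [z * u ^ q = \sum_i b_i * (f_i * u / x_i) ^ q] regularity makes
    [b_i] divisible by [x_i ^ q]. *)
Lemma separating_generators (s : seq R) : [set` s] `<=` M ->
  exists (u : R) (t : seq R), [/\ u != 0, [set` t] `<=` M,
    forall f, f \in s -> ideal_mul M (ideal_gen [set` t]) (u * f) &
    forall q z, ideal_gen [set` [seq v ^+ q | v <- t]] (z * u ^+ q) ->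
      ideal_gen [set` [seq v ^+ q | v <- s]] z].
Proof.
have [M0 MD MM] := local_ideal hlocal.
elim: s => [|f s IHs] sM.
  by exists 1, [::]; split=> [|v|f|q z] //=; rewrite ?oner_eq0 ?expr1n ?mulr1.
have [|u [t [u0 tM um sep]]] := IHs.
  by move=> v vs; apply: sM; rewrite /= inE [v \in s]vs orbT.
have Mf : M f by apply: sM; rewrite /= mem_head.
have [f0|f0] := eqVneq f 0.
  exists u, t; split=> // [g|q z /sep]; last first.
    by apply: ideal_gen_mono => v /= vs; rewrite inE vs orbT.
  rewrite inE => /orP[/eqP->|]; last exact: um.
  by rewrite f0 mulr0; case: (ideal_mul_ideal M (ideal_gen [set` t])).
have uf0 : u * f != 0 by rewrite mulf_neq0.
have [x Mx reg] := enough_regular (MM u f Mf) uf0.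
have x0 : x != 0.
  apply/eqP => x0; have [|r E] := reg 1 0; first by rewrite x0 mul0r mulr0.
  apply: (local_not1 hlocal); rewrite E mulrAC; exact: MM.
pose t' := u * f :: [seq x * v | v <- t].
have [T0 TD TM] : is_ideal (ideal_gen [set` t']) by apply: ideal_gen_ideal.
exists (u * x), t'; split.
- by rewrite mulf_neq0.
- move=> v /=; rewrite inE => /orP[/eqP->|/mapP[w wt ->]]; first exact: MM.
  by apply: MM; apply: tM.
- move=> g; rewrite inE => /orP[/eqP->|gs].
    rewrite mulrAC mulrC; apply: ideal_mul_in => //.
    by apply: ideal_gen_sub; rewrite /= mem_head.
  rewrite mulrAC; have := um g gs.
  apply: (ideal_mul_min (K := [set v | ideal_mul M (ideal_gen [set` t']) (v * x)])).
    by apply: ideal_preim; apply: ideal_mul_ideal.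
  move=> a b Ma tb /=; rewrite -mulrA; apply: ideal_mul_in => //.
  apply: (@ideal_gen_min _ _ [set v | ideal_gen [set` t'] (v * x)] _ _ _ tb).
    by apply: ideal_preim; apply: ideal_gen_ideal.
  move=> v vt /=; apply: ideal_gen_sub; rewrite /= inE mulrC map_f ?orbT //.
- move=> q z /ideal_gen_cons[r] /ideal_gen_scale[b tb E].
  have [|d Ed] := regular_modXX (i := q) (j := q) x0 uf0 reg (r := z * u ^+ q - b) (s := r).
    have -> : x ^+ q * (z * u ^+ q - b) = z * (u * x) ^+ q - x ^+ q * b.
      by rewrite exprMn; ring.
    by rewrite -E; ring.
  have : ideal_gen [set` [seq v ^+ q | v <- s]] (z - f ^+ q * d).
    apply: sep; suff -> : (z - f ^+ q * d) * u ^+ q = b by [].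
    have -> : b = z * u ^+ q - (u * f) ^+ q * d by rewrite -Ed; ring.
    by rewrite exprMn; ring.
  have [G0 GD GM] : is_ideal (ideal_gen [set` [seq v ^+ q | v <- f :: s]]).
    exact: ideal_gen_ideal.
  move=> sz; rewrite -(subrK (f ^+ q * d) z); apply: GD.
    by apply: ideal_gen_mono sz => v /= vs; rewrite inE vs orbT.
  by rewrite mulrC; apply: GM; apply: ideal_gen_sub; rewrite /= mem_head.
Qed.

Variable p : nat.
Hypothesis hchar : p \in [pchar R].

(** Take [u], [t] as above for generators of [M], so that [u] is in
    [(M I : M)] for all ideals [I] containing [t]. If [(M I : M)] were always
    [I^*], then [u ^ p] would be in [(M I^[p] : M)], which for [I] close to the
    ideal of [t] forces [M] into [M ^ 2]. The ideal [I] below is chosen so that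
    its Frobenius power avoids the given element [z * u ^ p]. *)
Lemma not_all_star_basically_full t : M t -> t != 0 ->
  ~ (forall I, primary_to M I -> star_basically_full p M I).
Proof.
move=> Mt t0 full; have hM := local_ideal hlocal; have [M0 MD MM] := hM.
have hp := pcharf_prime hchar.
have [s genM] := noeth hM.
have [|u [tt [u0 tM um sep]]] := separating_generators (s := s).
  by move=> v vs; rewrite genM; apply: ideal_gen_sub.
have [N [hN sqN [z Mz nNz]]] := square_proper hlocal Mt t0.
have nz : ~ ideal_gen [set` [seq v ^+ p | v <- tt]] (z * u ^+ p).
  move/sep => gz; apply: nNz; apply: (ideal_gen_min hN) gz => _ /mapP[v vs ->].
  have Mv : M v by rewrite genM; apply: ideal_gen_sub.
  apply: (ideal_expW (n := 2)) => //; first exact: prime_gt1.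
  by rewrite expr2; apply: sqN.
have [Q [hQ tQ nQ powQ]] := primary_separation hlocal (@ideal_gen_ideal _ _) nz.
pose I : set R := [set x | M x /\ Q (x ^+ p)].
have hI : is_ideal I.
  have := frobenius_preim_ideal hchar 1 hQ; rewrite expn1 => -[F0 FD FM].
  split=> [|x y [Mx Qx] [My Qy]|a x [Mx Qx]]; first by split.
    by split; [exact: MD|exact: FD].
  by split; [exact: MM|exact: FM].
have powI x : M x -> exists n, I (x ^+ n).
  move=> Mx; have [n Qn] := powQ x Mx; exists n.+1; split.
    by rewrite exprS; apply: ideal_mulr.
  by rewrite -exprM; apply: ideal_expW Qn => //; rewrite -[n in (n <= _)%N]muln1 leq_mul // prime_gt0.
have primI : primary_to M I by apply: (local_primary hlocal) => // x [].
pose J := frobenius_power I p.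
have primJ : primary_to M J.
  apply: (local_primary hlocal) => [||x Mx]; first exact: frobenius_power_ideal.
    apply: frobenius_power_min => // i [Mi _].
    by apply: (ideal_expW (n := 1)) => //; rewrite ?prime_gt0 ?expr1.
  have [n In] := powI x Mx; exists (n * p)%N.
  by rewrite exprM; apply: frobenius_power_in.
have tI : [set` tt] `<=` I.
  move=> v vt; split; first exact: tM.
  by apply: tQ; apply: ideal_gen_sub; apply: map_f.
have uI : tight_closure p I u.
  rewrite -(full I primI) => x; rewrite {1}genM mulrC.
  apply: (@ideal_gen_min _ _ [set x | ideal_mul M I (x * u)]).
    by apply: ideal_preim; apply: ideal_mul_ideal.
  move=> f fs /=; rewrite mulrC; move: (um f fs).
  apply: ideal_mul_min => [|a b Ma tb]; first exact: ideal_mul_ideal.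
  apply: ideal_mul_in => //; exact: (ideal_gen_min hI tI).
move/tight_closure_frobenius: uI; rewrite -(full J primJ) => /(_ z Mz).
move/(ideal_mul_subr (frobenius_power_ideal I p)); rewrite mulrC => Jzu.
by apply: nQ; apply: (frobenius_power_min hQ _ Jzu) => i [].
Qed.

End DepthTwo.

(** * The multiplier ring of the maximal ideal in dimension one *)

Section MultiplierRing.
Context {R : idomainType} (M : set R).
Hypothesis hlocal : local_ring M.
Local Notation K := {fraction R}.
Local Notation "x %:F" := (@tofrac R x).
Implicit Types (z w : K).

Lemma fraction_repr (z : K) : exists n d, d != 0 /\ z * d%:F = n%:F.
Proof.
elim/quotW: z => r; exists r.1, r.2; split; first exact: denom_ratioP.
unlock tofrac; rewrite -[LHS]FracField.pi_mul.
apply/eqP; rewrite piE /= FracField.equivfE /FracField.mulf /=.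
rewrite !numden_Ratio ?mulf_neq0 ?denom_ratioP ?oner_neq0 //= ?mulr1 ?mul1r ?oner_neq0 //.
by rewrite mulrC.
Qed.

Definition in_max z : Prop := exists2 s, M s & z = s%:F.

(** The ring [(M : M)]; it is the integral closure of [R] in the situations below. *)
Definition multiplier : set K := [set z | forall t, M t -> in_max (t%:F * z)].

Local Notation B := multiplier.

Lemma in_maxD z w : in_max z -> in_max w -> in_max (z + w).
Proof.
move=> [s Ms ->] [t Mt ->]; exists (s + t); last by rewrite tofracD.
by case: (local_ideal hlocal) => _ hD _; apply: hD.
Qed.

Lemma in_maxM a z : in_max z -> in_max (a%:F * z).
Proof.
move=> [s Ms ->]; exists (a * s); last by rewrite tofracM.
by case: (local_ideal hlocal) => _ _ hM; apply: hM.
Qed.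

Lemma multiplier_tofrac r : B r%:F.
Proof.
by move=> t Mt; rewrite mulrC; apply: in_maxM; exists t.
Qed.

Lemma multiplierD z w : B z -> B w -> B (z + w).
Proof. by move=> Bz Bw t Mt; rewrite mulrDr; apply: in_maxD; [apply: Bz|apply: Bw]. Qed.

Lemma multiplierM z w : B z -> B w -> B (z * w).
Proof. by move=> Bz Bw t Mt; rewrite mulrA; have [s Ms ->] := Bz t Mt; apply: Bw. Qed.

Lemma multiplier0 : B 0.
Proof. by rewrite -(tofrac0 R); apply: multiplier_tofrac. Qed.

Lemma multiplier1 : B 1.
Proof. by rewrite -(tofrac1 R); apply: multiplier_tofrac. Qed.

Lemma multiplierN z : B z -> B (- z).
Proof.
move=> Bz; rewrite -mulN1r; apply: multiplierM => //.
by rewrite -(tofrac1 R) -tofracN; apply: multiplier_tofrac.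
Qed.

Lemma multiplierX z n : B z -> B (z ^+ n).
Proof.
move=> Bz; elim: n => [|n IHn]; first by rewrite expr0; apply: multiplier1.
by rewrite exprS; apply: multiplierM.
Qed.

Lemma multiplier_horner (f : {poly R}) z : B z -> B (map_poly (@tofrac R) f).[z].
Proof.
move=> Bz; elim/poly_ind: f => [|f c IHf].
  by rewrite rmorph0 horner0; apply: multiplier0.
rewrite rmorphD rmorphM /= map_polyX map_polyC !hornerE.
by apply: multiplierD; [apply: multiplierM|apply: multiplier_tofrac].
Qed.

(** [B / M] is a finite-dimensional algebra over the residue field; in it the
    relation [f(b) = 0] is divided by its lowest non-zero term. *)
Lemma pi_regular_of_relation (b : K) (f : {poly R}) k : B b ->
  (exists i, ~ M f`_i) -> in_max (b ^+ k * (map_poly (@tofrac R) f).[b]) ->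
  exists j y, B y /\ in_max (b ^+ j * (1 - b * y)).
Proof.
move=> Bb; elim/poly_ind: f k => [|f c IHf] k [i nMi].
  by exfalso; apply: nMi; rewrite coef0; case: (local_ideal hlocal).
rewrite rmorphD rmorphM /= map_polyX map_polyC !hornerE.
have [Mc|/(local_unit hlocal)[v vc]] := pselect (M c); last first.
  move/(in_maxM v) => max_v.
  exists k, (- (v%:F * (map_poly (@tofrac R) f).[b])); split.
    apply: multiplierN; apply: multiplierM; first exact: multiplier_tofrac.
    exact: multiplier_horner.
  by have := max_v; congr in_max; rewrite -(tofrac1 R) -vc tofracM; ring.
move=> max_f; apply: (IHf k.+1).
  case: i nMi => [|i]; rewrite coefD coefMX coefC /=; first by rewrite add0r.
  by rewrite addr0 => nMi; exists i.
have max_c : in_max (c%:F * - b ^+ k).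
  by apply: multiplierN (Mc); apply: multiplierX.
have := in_maxD max_f max_c; congr in_max; rewrite exprS; ring.
Qed.

Context {t0 : R}.
Hypotheses (Mt0 : M t0) (t0_neq0 : t0 != 0).

Let t0F_neq0 : t0%:F != 0. Proof. by rewrite tofrac_eq0. Qed.

Lemma pi_regular (b : K) : B b -> exists j y, B y /\ in_max (b ^+ j * (1 - b * y)).
Proof.
move=> Bb; have [noeth _ _] := hlocal.
have /choice[a aP] : forall i, exists r, t0%:F * b ^+ i = r%:F.
  by move=> i; have [r _ Er] := multiplierX i Bb Mt0; exists r.
have [n [r an]] := noetherian_dependence a noeth.
have Ebn : b ^+ n = \sum_(i < n) (r i)%:F * b ^+ i.
  apply: (mulfI t0F_neq0); rewrite aP an rmorph_sum mulr_sumr /=.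
  by apply: eq_bigr => i _; rewrite tofracM -aP mulrCA.
apply: (@pi_regular_of_relation b ('X^n - \sum_(i < n) r i *: 'X^i) 0 Bb).
  exists n; rewrite coefB coefXn eqxx coef_sum big1 ?subr0; first exact: local_not1.
  by move=> i _; rewrite coefZ coefXn gtn_eqF ?mulr0.
rewrite rmorphB rmorph_sum /= map_polyXn hornerD hornerN hornerXn horner_sum.
exists 0; first by case: (local_ideal hlocal).
rewrite expr0 mul1r tofrac0 Ebn; apply/eqP; rewrite subr_eq0; apply/eqP.
by apply: eq_bigr => i _; rewrite map_polyZ /= map_polyXn hornerZ hornerXn.
Qed.

Section Density.
Hypothesis power_dvd : forall c x, c != 0 -> M x -> exists n, multiples c (x ^+ n).
Variable L : set K.
Hypotheses (LD : forall z w, L z -> L w -> L (z + w))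
  (LM : forall z w, B z -> L w -> L (z * w))
  (LB : L `<=` B)
  (L_neq0 : exists2 l, L l & l != 0)
  (L_dense : forall w, (forall l, L l -> B (w * l)) -> B w).

Let unit_mod u := L (1 - u) /\ B u.

Let unit_modM u v : unit_mod u -> unit_mod v -> unit_mod (u * v).
Proof.
move=> [Lu Bu] [Lv Bv]; split; last exact: multiplierM.
have -> : 1 - u * v = (1 - u) + u * (1 - v) by ring.
by apply: LD => //; apply: LM.
Qed.

Let unit_mod1 : unit_mod 1.
Proof.
split; last exact: multiplier1.
have [l Ll _] := L_neq0.
by rewrite subrr -(mul0r l); apply: LM => //; apply: multiplier0.
Qed.

Let unit_modX u n : unit_mod u -> unit_mod (u ^+ n).
Proof.
by move=> hu; elim: n => [|n IHn]; rewrite ?expr0 // exprS; apply: unit_modM.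
Qed.

Lemma power_annihilated (c : R) (s : seq K) : c != 0 -> (forall b, b \in s -> L b) ->
  exists2 u, L (1 - u) /\ B u & forall b, b \in s -> exists n, B (b ^+ n * (u / c%:F)).
Proof.
move=> c0; elim: s => [|b s IHs] sL.
  by exists 1.
have Lb : L b by apply: sL; rewrite mem_head.
have [|u hu uP] := IHs; first by move=> a sa; apply: sL; rewrite inE sa orbT.
have [j [y [By [x Mx Ex]]]] := pi_regular (LB Lb).
have [n [r Exn]] := power_dvd c0 Mx.
have hv : unit_mod (1 - b * y).
  split; first by rewrite subKr mulrC; apply: LM.
  by apply: multiplierD; [exact: multiplier1|apply: multiplierN; apply: multiplierM; first exact: LB].
exists ((1 - b * y) ^+ n * u); first by apply: unit_modM => //; apply: unit_modX.
move=> a; rewrite inE => /orP[/eqP->|/uP[k Bk]].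
  exists (j * n)%N; rewrite exprM.
  have -> : (b ^+ j) ^+ n * ((1 - b * y) ^+ n * u / c%:F)
           = (b ^+ j * (1 - b * y)) ^+ n * (u / c%:F) by rewrite exprMn; ring.
  rewrite Ex -tofracXn Exn tofracM.
  have -> : r%:F * c%:F * (u / c%:F) = r%:F * u.
    by field; rewrite tofrac_eq0.
  by apply: multiplierM; [exact: multiplier_tofrac|case: hu].
exists k; have -> : a ^+ k * ((1 - b * y) ^+ n * u / c%:F)
    = (1 - b * y) ^+ n * (a ^+ k * (u / c%:F)) by ring.
by apply: multiplierM => //; case: (unit_modX n hv).
Qed.

(** The Artinian ring [B / c B], with [c] in [L], is avoided: for generators
    [b] of [L] there is [u] in [1 + L] such that all [b ^ n * u] are in [c B].
    Density removes the powers of the [b] one factor at a time, so [u] is in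
    [c B], which is part of [L]. *)
Lemma dense_ideal_unit : L 1.
Proof.
have [noeth _ _] := hlocal; have M_ideal := local_ideal hlocal.
have t0K z : t0%:F * (z / t0%:F) = z by rewrite mulrC divfK.
have L0 : L 0.
  by have [l Ll _] := L_neq0; rewrite -(mul0r l); apply: LM => //; apply: multiplier0.
pose I : set R := [set r | L (r%:F / t0%:F)].
have [|s genI] := noeth I.
  split=> [|x y Ix Iy|a x Ix]; rewrite /I /= ?tofrac0 ?mul0r //.
    by rewrite tofracD mulrDl; apply: LD.
  by rewrite tofracM -mulrA; apply: LM => //; apply: multiplier_tofrac.
pose bs := [seq r%:F / t0%:F | r <- s].
have bsL b : b \in bs -> L b.
  move=> /mapP[r rs ->]; suff : I r by [].
  by rewrite genI; apply: ideal_gen_sub.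
have [c c0 Lc] : exists2 c, c != 0 & L c%:F.
  have [l Ll l0] := L_neq0; have [c _ Ec] := LB Ll Mt0.
  exists c; first by rewrite -tofrac_eq0 -Ec mulf_neq0.
  by rewrite -Ec; apply: LM => //; apply: multiplier_tofrac.
have remove_powers k : forall (e : K -> nat) w, (\sum_(b <- bs) e b < k)%N ->
    (forall b, b \in bs -> B (b ^+ e b * w)) -> B w.
  elim: k => [//|k IHk] e w lt_ek ew; apply: L_dense => l Ll.
  have wbs b : b \in bs -> B (w * b).
    move=> bbs; have Bb : B b by apply: LB; apply: bsL.
    have [eb0|eb_gt0] := posnP (e b).
      by apply: multiplierM => //; have := ew b bbs; rewrite eb0 expr0 mul1r.
    apply: (IHk (fun a => if a == b then (e b).-1 else e a)) => [|a abs].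
      apply: leq_trans (lt_ek : (_ <= k)%N).
      rewrite !(big_rem b bbs) /= eqxx -addSn prednK // leq_add2l.
      by apply: leq_sum => a _; case: eqP => [->|//]; exact: leq_pred.
    case: eqP => [->|_].
      by have := ew b bbs; rewrite -{1}(prednK eb_gt0) exprSr -mulrA (mulrC b).
    by rewrite mulrA; apply: multiplierM => //; apply: ew.
  have [r _ Er] := LB Ll Mt0.
  have El : l = r%:F / t0%:F by rewrite -Er mulrAC mulfV ?mul1r.
  have Ir : I r by rewrite /I /= -El.
  suff : [set x | B (w * (x%:F / t0%:F))] r by rewrite /= -El.
  move: Ir; rewrite genI; apply: ideal_gen_min => [|x xs]; last by apply: wbs; apply: map_f.
  split=> [|x y Bx By|a x Bx] /=.
  - by rewrite tofrac0 mul0r mulr0; apply: multiplier0.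
  - by rewrite tofracD mulrDl mulrDr; apply: multiplierD.
  - by rewrite tofracM -mulrA mulrCA; apply: multiplierM => //; apply: multiplier_tofrac.
have [u [L1u Bu] /= uP] := power_annihilated c0 bsL.
have Bw : B (u / c%:F).
  have [e eP] : exists e : K -> nat, forall b, b \in bs -> B (b ^+ e b * (u / c%:F)).
    have /choice[e eP] : forall b, exists n, b \in bs -> B (b ^+ n * (u / c%:F)).
      move=> b; have [/uP[n Bn]|nb] := boolP (b \in bs); first by exists n.
      by exists 0%N.
    by exists e.
  exact: (remove_powers _ e _ (ltnSn _)).
rewrite -(subrK u 1); apply: LD => //.
by rewrite -[u](divfK (x := c%:F)) ?tofrac_eq0 //; apply: LM.
Qed.

End Density.

(** * Dimension one *)

Variable p : nat.
Hypothesis hchar : p \in [pchar R].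
Hypothesis hdim : has_krull_dim R 1.
(* Normality of [B], phrased with Frobenius powers so as to apply directly to the
   elements in the definition of tight closure. *)
Hypothesis frobenius_closed : forall z c N, c != 0 ->
  (forall e, (N <= e)%N -> exists r, c%:F * z ^+ (p ^ e) = r%:F) -> B z.
Implicit Types I : set R.

Lemma multiplier_frobenius_closed z a N : a != 0 ->
  (forall e, (N <= e)%N -> B (a * z ^+ (p ^ e))) -> B z.
Proof.
move=> a0 Baz; have [n [d [d0 Ea]]] := fraction_repr a.
have n0 : n != 0 by rewrite -tofrac_eq0 -Ea mulf_neq0 ?tofrac_eq0.
apply: (@frobenius_closed z (t0 * n) N) => [|e le_Ne]; first by rewrite mulf_neq0.
have [s _ Es] := Baz e le_Ne t0 Mt0; exists (s * d).
by rewrite !tofracM -Ea -Es; ring.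
Qed.

Definition colon I : set K := [set w | forall i, I i -> B (i%:F * w)].

Definition add_closed (L : set K) : Prop :=
  L 0 /\ forall z w, L z -> L w -> L (z + w).

(** The product [I (B : I)], as the smallest additive set containing the
    elementary products: an additive property is then checked on these alone. *)
Definition colon_product I : set K :=
  smallest add_closed [set z | exists i w, [/\ I i, colon I w & z = i%:F * w]].

Lemma colon_product_min I L : add_closed L ->
  (forall i w, I i -> colon I w -> L (i%:F * w)) -> colon_product I `<=` L.
Proof. by move=> hL IL; apply: smallest_sub => // _ [i [w [Ii Iw ->]]]; apply: IL. Qed.

Lemma colon_product_in I i w : I i -> colon I w -> colon_product I (i%:F * w).
Proof. by move=> Ii Iw; apply: sub_gen_smallest; exists i, w. Qed.

Lemma colon_product_add_closed I : add_closed (colon_product I).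
Proof.
split=> [L [[]]//|z w gz gw L [hL IL]]; case: (hL) => _; apply.
  exact: (gz L (conj hL IL)).
exact: (gw L (conj hL IL)).
Qed.

Lemma colonM I z w : B z -> colon I w -> colon I (z * w).
Proof. by move=> Bz Iw i Ii; rewrite mulrCA; apply: multiplierM => //; apply: Iw. Qed.

(** An element multiplying [I (B : I)] into [B] multiplies [(B : I)] into
    itself, so its powers have a common denominator. *)
Lemma colon_product1 I i0 : I i0 -> i0 != 0 -> colon_product I 1.
Proof.
move=> Ii0 i0_neq0; have [_ CD] := colon_product_add_closed I.
have colon1 : colon I 1 by move=> i _; rewrite mulr1; apply: multiplier_tofrac.
apply: dense_ideal_unit => //.
- by move=> c x c0 Mx; apply: (dim1_power_dvd hlocal).
- move=> z w Bz; move: w; apply: colon_product_min => [|i w Ii Iw].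
    split=> [|v w Lv Lw] /=; first by rewrite mulr0; case: (colon_product_add_closed I).
    by rewrite mulrDr; apply: CD.
  by rewrite /= mulrCA; apply: colon_product_in => //; apply: colonM.
- apply: colon_product_min => [|i w Ii Iw]; last exact: Iw.
  by split; [exact: multiplier0|exact: multiplierD].
- by exists i0%:F; rewrite ?tofrac_eq0 // -(mulr1 i0%:F); apply: colon_product_in.
- move=> w wL.
  have wX n : colon I (w ^+ n).
    elim: n => [|n IHn]; first by rewrite expr0.
    by move=> i Ii; rewrite exprS mulrCA; apply: wL; apply: colon_product_in.
  apply: (@multiplier_frobenius_closed w i0%:F 0); rewrite ?tofrac_eq0 // => e _.
  exact: wX.
Qed.

Let hcharF : p \in [pchar K].
Proof. by rewrite inE (pcharf_prime hchar) -(rmorph_nat (@tofrac R)) (pcharf0 hchar) rmorph0 /=. Qed.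

(** Both inclusions come from [I^* = I B] restricted to [R] and [M B = M]. *)
Lemma dim1_star_basically_full I i0 : I i0 -> i0 != 0 -> star_basically_full p M I.
Proof.
move=> Ii0 i0_neq0; have one_I := colon_product1 Ii0 i0_neq0.
apply/seteqP; split=> x; last first.
  case=> c c0 [N cx] t Mt.
  have wx w : colon I w -> B (x%:F * w).
    move=> Iw; apply: (@multiplier_frobenius_closed _ c%:F N); rewrite ?tofrac_eq0 // => e le_Ne.
    have -> : c%:F * (x%:F * w) ^+ (p ^ e) = (c * x ^+ (p ^ e))%:F * w ^+ (p ^ e).
      by rewrite exprMn tofracM tofracXn mulrA.
    move: (c * _) (cx e le_Ne).
    apply: (frobenius_power_min (J := [set r | B (r%:F * w ^+ (p ^ e))])) => [|i Ii] /=.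
      split=> [|u v Bu Bv|a u Bu] /=.
      - by rewrite tofrac0 mul0r; apply: multiplier0.
      - by rewrite tofracD mulrDl; apply: multiplierD.
      - by rewrite tofracM -mulrA; apply: multiplierM => //; apply: multiplier_tofrac.
    by rewrite tofracXn -exprMn; apply: multiplierX; apply: Iw.
  pose L : set K := [set z | exists2 s, ideal_mul M I s & (x * t)%:F * z = s%:F].
  have [J0 JD _] := ideal_mul_ideal M I.
  have : L 1.
    apply: colon_product_min one_I => [|i w Ii Iw].
      split=> [|z w [r Jr Er] [s Js Es]]; first by exists 0; rewrite ?mulr0 ?tofrac0.
      by exists (r + s); [exact: JD|rewrite mulrDr Er Es tofracD].
    have [s Ms Es] := wx w Iw t Mt.
    exists (s * i); first exact: ideal_mul_in.
    by rewrite !tofracM -Es; ring.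
  by case=> s Js; rewrite mulr1 => /eqP; rewrite tofrac_eq => /eqP->.
move=> xM; exists t0 => //; exists 0%N => e _.
pose q := (p ^ e)%N.
have [F0 FD FM] := frobenius_power_ideal I q.
pose X : set K := [set z | exists2 s, frobenius_power I q s & t0%:F * z ^+ q = s%:F].
have [X0 XD] : add_closed X.
  split=> [|z w [r Fr Er] [s Fs Es]].
    by exists 0 => //; rewrite expr0n /q gtn_eqF ?(expp_gt0 hchar) //= mulr0 tofrac0.
  by exists (r + s); [exact: FD|rewrite pchar_exprD // mulrDr Er Es tofracD].
have XI i z : I i -> B z -> X (i%:F * z).
  move=> Ii Bz; have [s _ Es] := multiplierX q Bz Mt0.
  exists (s * i ^+ q); first by apply: FM; apply: frobenius_power_in.
  by rewrite exprMn mulrCA Es tofracM tofracXn mulrC.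
suff : X x%:F by case=> s Fs; rewrite -tofracXn -tofracM => /eqP; rewrite tofrac_eq => /eqP->.
have one_M := colon_product1 Mt0 t0_neq0.
suff : [set z | X (x%:F * z)] 1 by rewrite /= mulr1.
apply: colon_product_min one_M => [|t w Mt Mw] /=.
  split=> [|z w Xz Xw] /=; first by rewrite mulr0.
  by rewrite mulrDr; apply: XD.
rewrite mulrA -tofracM; move: (x * t) (xM t Mt).
apply: (ideal_mul_min (K := [set r | X (r%:F * w)])) => [|s i Ms Ii] /=; last first.
  by rewrite [s * i]mulrC tofracM -mulrA; apply: XI => //; apply: Mw.
split=> [|u v Xu Xv|a u [s Fs Es]] /=; first by rewrite tofrac0 mul0r.
  by rewrite tofracD mulrDl; apply: XD.
exists (a ^+ q * s); first exact: FM.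
by rewrite tofracM -mulrA exprMn mulrCA Es tofracM tofracXn.
Qed.

End MultiplierRing.

(** * Test ideals, normality and bounded Frobenius orbits *)

Section FrobeniusClosed.
Context {R : idomainType} {M : set R} {p : nat}.
Hypotheses (hlocal : local_ring M) (hchar : p \in [pchar R]).
Local Notation K := {fraction R}.
Local Notation "x %:F" := (@tofrac R x).

(** For [z = a / b], boundedness says that [a] is in the tight closure of [(b)],
    so the test ideal multiplies [z] into [R]. It even multiplies [z] into [M]:
    if [t * z] were a unit, then [c] would be divisible by all powers of [t]. *)
Lemma test_ideal_frobenius_closed (z : K) c N : test_ideal p = M -> c != 0 ->
  (forall e, (N <= e)%N -> exists r, c%:F * z ^+ (p ^ e) = r%:F) -> multiplier M z.
Proof.
move=> testM c0 zbound t Mt.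
have [a [b [b0 Ea]]] := fraction_repr z.
have ab : tight_closure p (multiples b) a.
  exists c => //; exists N => e /zbound[r Er].
  have -> : c * a ^+ (p ^ e) = r * b ^+ (p ^ e).
    by apply/eqP; rewrite -tofrac_eq !tofracM !tofracXn -Ea exprMn mulrA Er.
  by case: (frobenius_power_ideal (multiples b) (p ^ e)) => _ _; apply; exact: frobenius_power_in (multiples_self b).
have [s Es] : multiples b (t * a).
  by have := Mt; rewrite -testM => /(_ (multiples b) (multiples_ideal b)); apply.
have Etz : t%:F * z = s%:F.
  apply: (mulIf (_ : b%:F != 0)); first by rewrite tofrac_eq0.
  by rewrite -mulrA Ea -!tofracM Es.
exists s => //; apply: contrapT => /(local_unit hlocal)[v vs].
move/eqP: c0; apply; apply: (krull_principal hlocal Mt) => n.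
have lt_n : (n <= p ^ (n + N))%N.
  by apply: leq_trans (leq_addr N n) (ltnW (ltn_expl _ _)); rewrite prime_gt1 // (pcharf_prime hchar).
have [r Er] := zbound (n + N)%N (leq_addl _ _).
set q := (p ^ (n + N))%N in lt_n Er.
have -> : c = v ^+ q * r * t ^+ (q - n) * t ^+ n.
  rewrite -mulrA -exprD subnK //; apply: (mulIf (_ : s ^+ q != 0)).
    by rewrite expf_neq0 //; apply: contra_eq_neq vs => ->; rewrite mulr0 eq_sym oner_neq0.
  rewrite -!mulrA [X in v ^+ q * X]mulrA [X in v ^+ q * X]mulrC mulrA -exprMn vs expr1n mul1r.
  apply/eqP; rewrite -tofrac_eq !tofracM !tofracXn -Er -Etz exprMn; apply/eqP; ring.
by exists (v ^+ q * r * t ^+ (q - n)).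
Qed.

(** With [c] bounding all [z ^ (p ^ e)], a dependence between the elements
    [c * z ^ (p ^ e)] of the Noetherian ring [R] is an integral equation. *)
Lemma normal_frobenius_closed (z : K) c N : normal_domain R -> c != 0 ->
  (forall e, (N <= e)%N -> exists r, c%:F * z ^+ (p ^ e) = r%:F) -> multiplier M z.
Proof.
move=> normalR c0 zbound; have [noeth _ _] := hlocal.
have c0F : c%:F != 0 by rewrite tofrac_eq0.
have /choice[a aP] : forall i, exists r, c%:F * z ^+ (p ^ (N + i)) = r%:F.
  by move=> i; apply: zbound; apply: leq_addr.
have [n [r an]] := noetherian_dependence a noeth.
suff [x ->] : exists x, z = x%:F by exact: multiplier_tofrac.
apply: normalR.
pose f : {poly R} := 'X^(p ^ (N + n)) - \sum_(i < n) r i *: 'X^(p ^ (N + i)).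
exists f; last first.
  rewrite /root /f rmorphB rmorph_sum /= map_polyXn hornerD hornerN hornerXn horner_sum subr_eq0.
  apply/eqP; apply: (mulfI c0F); rewrite aP an rmorph_sum mulr_sumr /=.
  by apply: eq_bigr => i _; rewrite tofracM -aP map_polyZ /= map_polyXn hornerZ hornerXn mulrCA.
have p1 : (1 < p)%N by rewrite prime_gt1 // (pcharf_prime hchar).
rewrite monicE /f lead_coefDl ?lead_coefXn // size_polyN size_polyXn.
rewrite ltnS; apply: leq_trans (size_sum _ _ _) _; apply/bigmax_leqP => i _.
apply: leq_trans (size_scale_leq _ _) _.
by rewrite size_polyXn ltn_exp2l // ltn_add2l.
Qed.

End FrobeniusClosed.

(** * Separating the dimensions *)

Lemma primary_nonzero (R : idomainType) (M I : set R) t : M t -> t != 0 ->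
  primary_to M I -> exists2 i, I i & i != 0.
Proof.
move=> Mt t0 [_ radI]; move: Mt; rewrite -radI => -[n In].
by exists (t ^+ n) => //; apply: expf_neq0.
Qed.

Lemma dim0_zero (R : idomainType) (M : set R) : local_ring M ->
  has_krull_dim R 0 -> M = [set 0].
Proof.
move=> hlocal [_ dim0]; apply/seteqP; split=> [x Mx /=|_ ->]; last first.
  by case: (local_ideal hlocal).
apply: contrapT => x0.
have := dim0 1%N (fun i => if i is 0%N then [set 0] else M).
move=> /(_ _)/negP; apply=> //; split=> [[|[|//]] _|[|//] _].
- exact: zero_prime_ideal.
- exact: local_prime_ideal hlocal.
- split=> [_ ->|/(_ x Mx) //]; by case: (local_ideal hlocal).
Qed.

(** In a field the zero ideal is primary and tightly closed, whereas [(0 : 0)] is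
    the whole ring. *)
Lemma field_not_star_basically_full (R : idomainType) p : p \in [pchar R] ->
  primary_to [set 0 : R] [set 0] /\ ~ star_basically_full p [set 0 : R] [set 0].
Proof.
move=> hchar; have h0 := @zero_ideal R; have [_ neqT mul0P] := zero_prime_ideal (R := R).
split; first split.
- split=> // x y /mul0P[]; [by left|right]; by exists 1%N; rewrite expr1.
- apply/seteqP; split=> x /=; last by exists 1%N; rewrite expr1.
  by case=> n /eqP; rewrite expf_eq0 => /andP[_ /eqP].
move=> full; have : ideal_colon (ideal_mul [set 0] [set 0]) [set 0] (1 : R).
  by move=> x ->; rewrite mulr0; case: (ideal_mul_ideal [set 0 : R] [set 0]).
rewrite full => -[c c0 [N /(_ N (leqnn _))]]; rewrite expr1n mulr1.
move=> Fc; move/eqP: c0; apply; apply: (frobenius_power_min h0 _ Fc) => _ ->.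
by rewrite /= expr0n gtn_eqF ?(expp_gt0 hchar).
Qed.

Theorem theorem3p2 (R : idomainType) (m : idealr R) (p : nat)
    (hlocal : local_ring [set` m])
    (hCM : cohen_macaulay [set` m])
    (hchar : p \in [pchar R]) :
  (has_krull_dim R 1 -> test_ideal p = [set` m] ->
     forall I : set R, primary_to [set` m] I ->
       star_basically_full p [set` m] I) /\
  (normal_domain R -> perfect_field {ideal_quot m} ->
     (has_krull_dim R 1 <->
      forall I : set R, primary_to [set` m] I ->
        star_basically_full p [set` m] I)).
Proof.
have dim1_full : has_krull_dim R 1 ->
    (forall z c N, c != 0 -> (forall e, (N <= e)%N ->
       exists r, tofrac c * z ^+ (p ^ e) = tofrac r) -> multiplier [set` m] z) ->
    forall I : set R, primary_to [set` m] I -> star_basically_full p [set` m] I.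
  move=> dim1 closed I primI; have [t mt t0] := dim1_nonzero hlocal dim1.
  have [i Ii i0] := primary_nonzero mt t0 primI.
  exact: (dim1_star_basically_full hlocal mt t0 hchar dim1 closed Ii i0).
split=> [dim1 testm|normalR _].
  apply: dim1_full => // z c N; exact: test_ideal_frobenius_closed.
split=> [dim1|full].
  apply: dim1_full => // z c N; exact: normal_frobenius_closed.
have [d dimd [[s [regs sm sized]] _]] := hCM.
case: d => [|[|d]] in dimd sized; last 2 first.
- exact: dimd.
- exfalso; case: s => [|x1 [|x2 s]]// in regs sm sized.
  have [_ reg] := regs.
  have x10 : x1 != 0.
    apply/eqP => x10; have := reg 0%N isT 1; rewrite take0 /= x10 mul0r => h.
    have [h0 _ _] := ideal_gen_ideal [set` [::] : seq R].
    by move/eqP: (ideal_gen_nil (h h0)); rewrite oner_eq0.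
  have gen1 : forall x, ideal_gen [set` [:: x1]] x <-> multiples x1 x.
    move=> x; split=> [|[r ->]].
      apply: ideal_gen_min => [|y /=]; first exact: multiples_ideal.
      by rewrite inE => /eqP->; apply: multiples_self.
    case: (ideal_gen_ideal [set` [:: x1]]) => _ _; apply.
    by apply: ideal_gen_sub; rewrite /= mem_head.
  have reg21 : regular_mod x2 x1.
    move=> a b E; have := reg 1%N isT a; rewrite /= ?take0 => h.
    have /gen1[b' ->] : ideal_gen [set` [:: x1]] a.
      by apply: h; apply/gen1; exists b; rewrite E mulrC.
    by exists b'; rewrite mulrC.
  have mx1 : [set` m] x1 by apply: sm; rewrite /= mem_head.
  have mx2 : [set` m] x2 by apply: sm; rewrite /= inE mem_head orbT.
  apply: (not_all_star_basically_full hlocal _ hchar mx1 x10 full) => y _ y0.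
  exact: regular_mod_exists mx1 mx2 x10 reg21 y0.
exfalso; have m0 := dim0_zero hlocal dimd.
have [prim0 nfull] := field_not_star_basically_full hchar.
by apply: nfull; rewrite -m0; apply: full; rewrite m0.
Qed.
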